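(* Let $\mathcal L$ be a cubic algebra, $\mathsf I$ a special subalgebra of $\mathcal L$ and $g\in\mathcal L$. Then $\mathsf I_g=\{\Delta(g\vee f,f): f\in\mathsf I\}$ is a special subalgebra of $\mathcal L$, and $[\![\mathsf I_g]\!]=[\![\mathsf I]\!]$.
   Context: A cubic algebra is a join-semilattice $\mathcal L$ with top $\mathbf 1$ and a binary operation $\Delta$ such that: if $x\le y$ then $\Delta(y,x)\vee x=y$; if $x\le y\le z$ then $\Delta(z,\Delta(y,x))=\Delta(\Delta(z,y),\Delta(z,x))$; if $x\le y$ then $\Delta(y,\Delta(y,x))=x$; if $x\le y\le z$ then $\Delta(z,x)\le\Delta(z,y)$; and with $xy:=\Delta(\mathbf 1,\Delta(x\vee y,y))\vee y$ one has $(xy)y=x\vee y$ and $x(yz)=y(xz)$. With $xy$, $\mathcal L$ is an implication algebra; an implication subalgebra is a subset closed under it. For $X\subseteq\mathcal L$, $[\![X]\!]$ denotes the cubic subalgebra generated by $X$ (closure under $\vee$, $\Delta$, containing $\mathbf 1$). A subset $A\subseteq\mathcal L$ is compatible iff for every embedding $e$ of $\mathcal L$ into an interval algebra of a Boolean algebra, $e[A]$ has the finite intersection property; equivalently, $x\vee\Delta(\mathbf 1,y)=\mathbf 1$ for all $x,y\in A$. A special subalgebra of $\mathcal L$ is an upwards-closed implication subalgebra $I$ that is compatible and such that for all $x,y\in I$, if $x\wedge y$ exists in $\mathcal L$ then $x\wedge y\in I$. *)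

(* Defs.v *)
From HB Require Import structures.
From mathcomp Require Import all_boot all_order.
From mathcomp Require Import classical_sets filter.

Set Implicit Arguments.
Unset Strict Implicit.
Unset Printing Implicit Defensive.
Import Order.Theory.
Local Open Scope order_scope.

(* xy := Delta(1, Delta(x \/ y, y)) \/ y, for an arbitrary binary operation D;
   x is the antecedent: in an interval algebra xy is the relative implication
   x -> y, so that xx = 1, 1y = y and (xy)y = x \/ y. *)
Definition imp_of (d : Order.disp_t) (L : tJoinSemilatticeType d)
    (D : L -> L -> L) (x y : L) : L :=
  D \top (D (x `|` y) y) `|` y.

HB.mixin Record isCubic (d : Order.disp_t) L
    of Order.TJoinSemilattice d L := {
  delta : L -> L -> L;
  delta_joinK : forall x y : L, x <= y -> delta y x `|` x = y;
  delta_delta : forall x y z : L, x <= y -> y <= z ->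
    delta z (delta y x) = delta (delta z y) (delta z x);
  deltaK : forall x y : L, x <= y -> delta y (delta y x) = x;
  delta_le : forall x y z : L, x <= y -> y <= z -> delta z x <= delta z y;
  cubic_impK : forall x y : L,
    imp_of delta (imp_of delta x y) y = x `|` y;
  cubic_impCA : forall x y z : L,
    imp_of delta x (imp_of delta y z) = imp_of delta y (imp_of delta x z)
}.

(* The axioms leave delta y x unconstrained unless x <= y.  Accordingly,
   subalgebras and embeddings below only refer to delta y x for x <= y:
   delta is in effect a partial operation with junk values elsewhere. *)
#[short(type="cubicType")]
HB.structure Definition Cubic (d : Order.disp_t) :=
  { L of Order.TJoinSemilattice d L & isCubic d L }.

Section CubicNotions.
Context {d : Order.disp_t} {L : cubicType d}.
Implicit Types (x y m : L) (A X I : set L).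

Definition cimp x y : L := imp_of delta x y.

Definition cubic_subalgebra A : Prop :=
  [/\ A \top,
      forall x y, A x -> A y -> A (x `|` y) &
      forall x y, A x -> A y -> x <= y -> A (delta y x)].

Definition cubic_gen X : set L := smallest cubic_subalgebra X.

Definition implication_subalgebra A : Prop :=
  forall x y, A x -> A y -> A (cimp x y).

Definition upwards_closed A : Prop := forall x y, A x -> x <= y -> A y.

Definition is_meet x y m : Prop :=
  [/\ m <= x, m <= y & forall z : L, z <= x -> z <= y -> z <= m].

End CubicNotions.

Section IntervalAlgebra.
Context {dB : Order.disp_t} (B : ctbDistrLatticeType dB).

(* The pair (a, b) with a <= b stands for the nonempty closed interval [a, b]
   of B; the interval algebra is ordered by inclusion. *)
Definition intervals : Type := {ab : B * B | ab.1 <= ab.2}.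

Definition ipoints (i : intervals) : set B :=
  fun p => (val i).1 <= p <= (val i).2.

Definition ivl_top : intervals :=
  exist (fun ab : B * B => ab.1 <= ab.2) (\bot, \top) (le0x (\top : B)).

Definition ivl_join_pair (i j : intervals) : B * B :=
  ((val i).1 `&` (val j).1, (val i).2 `|` (val j).2).

Lemma ivl_join_subproof (i j : intervals) :
  (ivl_join_pair i j).1 <= (ivl_join_pair i j).2.
Proof. by apply: (le_trans (leIl _ _)); apply: lexUl; apply: (valP i). Qed.

Definition ivl_join (i j : intervals) : intervals :=
  exist _ (ivl_join_pair i j) (ivl_join_subproof i j).

(* Delta([a, b], [c, e]) = [a \/ (b /\ ~e), b /\ (a \/ ~c)]; when
   [c, e] is contained in [a, b] this is the reflection of [c, e] through the
   centre of [a, b], i.e. complementation relative to [a, b]. *)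
Definition ivl_delta_pair (i j : intervals) : B * B :=
  let: (a, b) := val i in let: (c, e) := val j in
  (a `|` (b `&` ~` e), b `&` (a `|` ~` c)).

Lemma ivl_delta_subproof (i j : intervals) :
  (ivl_delta_pair i j).1 <= (ivl_delta_pair i j).2.
Proof.
case: i j => [[a b] /= ab] [[c e] /= ce]; rewrite /ivl_delta_pair /=.
rewrite leUx !lexI ab leUl leIl /=.
by apply: (le_trans (leIr _ _)); apply: lexUr; rewrite leC.
Qed.

Definition ivl_delta (i j : intervals) : intervals :=
  exist _ (ivl_delta_pair i j) (ivl_delta_subproof i j).

End IntervalAlgebra.

Section Special.
Context {d : Order.disp_t} {L : cubicType d}.
Implicit Types (A I : set L) (g : L).

Definition cubic_embedding {dB : Order.disp_t} {B : ctbDistrLatticeType dB}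
    (e : L -> intervals B) : Prop :=
  [/\ injective e,
      e \top = ivl_top B,
      forall x y : L, e (x `|` y) = ivl_join (e x) (e y) &
      forall x y : L, x <= y -> e (delta y x) = ivl_delta (e y) (e x)].

(* [finI A (fun x => ipoints (e x))] says that any finitely many of the
   intervals e x, x in A, have a common point. *)
Definition compatible A : Prop :=
  forall (dB : Order.disp_t) (B : ctbDistrLatticeType dB)
    (e : L -> intervals B),
  cubic_embedding e -> finI A (fun x => ipoints (e x)).

Definition special I : Prop :=
  [/\ upwards_closed I,
      implication_subalgebra I,
      compatible I &
      forall x y m : L, I x -> I y -> is_meet x y m -> I m].

(* I_g = {Delta(g \/ f, f) : f in I} *)
Definition translate I g : set L :=
  (fun f => delta (g `|` f) f) @` I.

End Special.

(* Main.v *)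
Require Import Defs.
From mathcomp Require Import all_boot all_order.
From mathcomp Require Import boolp classical_sets finmap filter.

(* For elements y, h with a common lower bound, delta(y \/ h, h) still joins y to
   y \/ h (join_delta_join), so every y >= u induces an order isomorphism
   h |-> delta(y \/ h, h) from [u, 1] onto [delta(y, u), 1], inverse to the map given
   by the same formula.  Upward closure of I_g is this fact for y = g \/ f.
   For meets, let m be the meet of the translates x, y of f1, f2 in I, and put
   a = g \/ f1, b = g \/ f2.  With z = x -> y and s = a /\ (b \/ z), the
   isomorphism given by s carries x, z and their meet m to f1, to some
   f2' >= f2, and to k = delta(s, m); so k = f1 /\ f2' lies in I, and distributivity
   over k gives g \/ k = s, i.e. k translates to m. *)

Set Implicit Arguments.
Unset Strict Implicit.
Unset Printing Implicit Defensive.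
Import Order.Theory.
Local Open Scope order_scope.

Arguments delta_joinK {d s x y} _.
Arguments deltaK {d s x y} _.
Arguments delta_le {d s x y z} _ _.

Section CubicTheory.
Context {d : Order.disp_t} {L : cubicType d}.
Implicit Types (a b f g h k m p q r s t u w x y z : L) (I : set L).

(** * The reflection [delta w] on the elements below [w] *)

Lemma delta_id x : delta x x = x.
Proof.
have le_dx : delta x x <= x by rewrite -[leRHS](delta_joinK (lexx x)) leUl.
apply/le_anti; rewrite le_dx /=.
by rewrite -[leLHS](deltaK (lexx x)); exact: delta_le.
Qed.

Lemma delta_ge x y : x <= y -> delta y x <= y.
Proof. by move=> xy; rewrite -[leRHS](delta_joinK xy) leUl. Qed.

Lemma delta_swap x y w : x <= w -> y <= w -> delta w x <= y -> x <= delta w y.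
Proof. by move=> xw yw H; rewrite -[leLHS](deltaK xw); exact: delta_le. Qed.

Lemma delta_join w p q : p <= w -> q <= w ->
  delta w (p `|` q) = delta w p `|` delta w q.
Proof.
move=> pw qw; have pqw : p `|` q <= w by rewrite leUx pw.
apply/le_anti/andP; split; last first.
  by rewrite leUx !delta_le ?leUl ?leUr.
have djw : delta w p `|` delta w q <= w by rewrite leUx !delta_ge.
rewrite -[leRHS](deltaK djw); apply: delta_le; last exact: delta_ge.
by rewrite leUx !delta_swap ?leUl ?leUr.
Qed.

(** * Implication, meets of elements with a lower bound, distributivity *)

Lemma imp_le x y : x <= y -> cimp x y = \top.
Proof.
move=> xy; rewrite /cimp /imp_of (join_idPr xy) delta_id.
by rewrite delta_joinK ?lex1.
Qed.

Lemma imp1x x : cimp \top x = x.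
Proof. by rewrite /cimp /imp_of join1x deltaK ?lex1 // joinxx. Qed.

Lemma imp_eq1 x y : cimp x y = \top -> x <= y.
Proof.
move=> H; have := cubic_impK x y; rewrite -!/(cimp _ _) H imp1x => ->.
exact: leUl.
Qed.

Lemma le_imp x y : y <= cimp x y.
Proof. exact: leUr. Qed.

Lemma imp_adj p x y : p <= cimp x y -> x <= cimp p y.
Proof.
move=> H; apply: imp_eq1; have := cubic_impCA x p y.
by rewrite -!/(cimp _ _) => ->; exact: imp_le.
Qed.

Lemma imp_antitone x y z : x <= z -> cimp z y <= cimp x y.
Proof. by move=> xz; apply: imp_adj; apply: (le_trans xz); exact: imp_adj. Qed.

(** As z = (z -> y) -> y, exchanging antecedents gives x -> z = (z -> y) -> (x -> y). *)
Lemma imp_monotone x y z : y <= z -> cimp x y <= cimp x z.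
Proof.
move=> yz; have := cubic_impK z y; rewrite (join_idPl yz) -!/(cimp _ _) => <-.
have := cubic_impCA x (cimp z y) y; rewrite -!/(cimp _ _) => ->.
exact: le_imp.
Qed.

Lemma join_imp x y : x `|` cimp x y = \top.
Proof.
have yxy : y <= x `|` y by exact: leUr.
apply/le_anti; rewrite lex1 /= /cimp /imp_of joinCA.
rewrite -[leLHS](delta_joinK (lex1 (delta (x `|` y) y))).
by rewrite leU2 ?lexx ?delta_ge.
Qed.

Lemma modus_ponens p x y : p <= x -> p <= cimp x y -> p <= y.
Proof.
move=> px pxy.
have ppy : p <= cimp p y by apply: (le_trans px); exact: imp_adj.
by apply: imp_eq1; rewrite -(join_imp p y); apply/esym/join_idPr.
Qed.

(** In [u, 1] the map v |-> (v -> u) is complementation, so De Morgan's law supplies the witness. *)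
Lemma meet_exists u p q : u <= p -> u <= q -> exists w, is_meet p q w.
Proof.
move=> up uq; exists (cimp (cimp p u `|` cimp q u) u).
have dneg v : u <= v -> cimp (cimp v u) u = v.
  by move=> uv; have := cubic_impK v u; rewrite (join_idPl uv).
split.
- by rewrite -[leRHS](dneg p) //; apply: imp_antitone; exact: leUl.
- by rewrite -[leRHS](dneg q) //; apply: imp_antitone; exact: leUr.
- by move=> t tp tq; apply: imp_adj; rewrite leUx !imp_antitone.
Qed.

Lemma is_meetC p q w : is_meet p q w -> is_meet q p w.
Proof. by case=> wp wq H; split=> // z zq zp; exact: H. Qed.

Lemma meet_residuation p q w r : is_meet p q w -> w <= r -> p <= cimp q r.
Proof.
case=> wp wq wmax wr; apply: le_trans (imp_monotone _ wr).
apply: imp_eq1; set v := cimp p _.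
have wv : w <= v by apply: (le_trans _ (le_imp _ _)); exact: le_imp.
have dneg x : w <= x -> cimp (cimp x w) w = x.
  by move=> wx; have := cubic_impK x w; rewrite (join_idPl wx).
(* It remains to see v -> w <= w; maximality of [w] reduces this to bounds by [p] and by [q]. *)
rewrite -(dneg v wv); apply: imp_le; apply: wmax.
- rewrite -[leRHS](dneg p wp); apply: imp_antitone.
  by apply: imp_monotone; exact: le_imp.
- by rewrite -[leRHS](dneg q wq); apply: imp_antitone; exact: le_imp.
Qed.

(** Distributivity: q = q \/ (x /\ y) = (q \/ x) /\ (q \/ y). *)
Lemma le_joins_meet p q x y k : is_meet x y k -> k <= q ->
  p <= q `|` x -> p <= q `|` y -> p <= q.
Proof.
move=> kP kq pqx pqy; apply: (modus_ponens (lexx p)).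
apply: (le_trans pqy); rewrite leUx le_imp /=; apply: imp_adj.
by apply: (le_trans pqx); rewrite leUx le_imp (meet_residuation kP).
Qed.

(** Distributivity again: (a /\ t) \/ x = (a \/ x) /\ (t \/ x) = a /\ 1. *)
Lemma join_meet_cover a t x s : is_meet a t s -> x <= a -> t `|` x = \top ->
  s `|` x = a.
Proof.
move=> sP xa tx1; have [sa _ _] := sP.
apply/le_anti; rewrite leUx sa xa /=; apply: (modus_ponens (lexx a)).
apply: (le_trans (lex1 a)); rewrite -tx1 leUx; apply/andP; split.
  by apply: (meet_residuation (is_meetC sP)); exact: leUl.
by apply: (le_trans _ (le_imp _ _)); exact: leUr.
Qed.

Lemma delta_delta_le_imp x y w : x <= y -> y <= w ->
  delta w (delta y x) <= cimp y x.
Proof.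
move=> xy yw; set u := delta y x.
have uy : u <= y by exact: delta_ge.
have uw : u <= w by exact: le_trans yw.
(* Reflecting in 1 exchanges y -> x and y -> u. After [delta_swap] the left side is a joinand of w
   -> u, which is below y -> u. *)
have -> : cimp y x = delta \top (cimp y u).
  rewrite /cimp /imp_of (join_idPl xy) (join_idPl uy) delta_join ?lex1 //.
  by rewrite deltaK ?lex1 // deltaK // joinC.
apply: delta_swap; rewrite ?lex1 //.
apply: le_trans (imp_antitone _ yw).
by rewrite /cimp /imp_of (join_idPl uw); exact: leUl.
Qed.

(** Both sides are complements of [y] in the Boolean interval [u, y \/ h], and complements are
    unique. *)
Lemma delta_meet_join y h u : is_meet y h u ->
  delta (y `|` h) (delta y u) `|` u = h.
Proof.
move=> uP; have [uy uh _] := uP; set w := y `|` h; set e := _ `|` u.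
have yw : y <= w by exact: leUl.
have duw : delta y u <= w by apply: le_trans yw; exact: delta_ge.
have ew : e <= w by rewrite leUx delta_ge // (le_trans uy).
have we : w <= e `|` y.
  rewrite -[leLHS](delta_joinK duw) leU2 //; first exact: leUl.
  exact: delta_ge.
have ei : e <= cimp y u by rewrite leUx le_imp delta_delta_le_imp.
apply/le_anti/andP; split; apply: modus_ponens (lexx _) _.
  apply: (le_trans ew); rewrite leUx le_imp andbT.
  by apply: (le_trans (imp_adj ei)); exact: imp_monotone.
apply: (le_trans (leUr h y)); apply: (le_trans we); rewrite leUx le_imp /=.
by apply: (meet_residuation uP); exact: leUr.
Qed.

Lemma delta_joinE y h u : is_meet y h u ->
  delta (y `|` h) h = delta y u `|` delta (y `|` h) u.
Proof.
move=> uP; have [uy _ _] := uP; have yw : y <= y `|` h by exact: leUl.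
have duw : delta y u <= y `|` h by apply: le_trans yw; exact: delta_ge.
rewrite -[in LHS](delta_meet_join uP) {1}(delta_meet_join uP).
by rewrite delta_join ?deltaK // ?delta_ge // (le_trans uy).
Qed.

Lemma join_delta_join u y h : u <= y -> u <= h ->
  y `|` delta (y `|` h) h = y `|` h.
Proof.
move=> uy uh; have [v vP] := meet_exists uy uh; have [vy vh _] := vP.
have vw : v <= y `|` h by exact: le_trans (leUl _ _).
apply/le_anti; rewrite leUx leUl delta_ge ?leUr //=.
rewrite -[leLHS](delta_joinK vw) leUx (le_trans vy (leUl _ _)) andbT.
by rewrite (delta_joinE vP) joinA leUr.
Qed.

Lemma delta_le_join u y h : u <= y -> u <= h ->
  delta y u <= delta (y `|` h) h.
Proof.
move=> uy uh; have [v vP] := meet_exists uy uh; have [vy vh vmax] := vP.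
rewrite (delta_joinE vP); apply: (le_trans _ (leUl _ _)).
by apply: delta_le => //; exact: vmax.
Qed.

Lemma delta_join_inv u y h : u <= y -> u <= h ->
  delta (y `|` delta (y `|` h) h) (delta (y `|` h) h) = h.
Proof. by move=> uy uh; rewrite (join_delta_join uy uh) deltaK ?leUr. Qed.

Lemma delta_join_le u y h k : u <= y -> u <= h -> h <= k ->
  delta (y `|` h) h <= delta (y `|` k) k.
Proof.
move=> uy uh hk; have hyh : h <= y `|` h by exact: leUr.
by have := delta_le_join hyh hk; rewrite -joinA (join_idPr hk).
Qed.

Lemma delta_meet s x z m : m <= s -> is_meet x z m ->
  is_meet (delta (s `|` x) x) (delta (s `|` z) z) (delta s m).
Proof.
move=> ms [mx mz mmax]; have ks := delta_ge ms.
have kx := delta_le_join ms mx; have kz := delta_le_join ms mz.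
split=> // q qx qz.
(* The inverse map is controlled only above [delta s m], so [q] is enlarged to [p]; this goes back
   below [x] and [z], hence to [m]. *)
have kqk : delta s m <= delta s m `|` q by exact: leUl.
set p := delta s m `|` q in kqk.
have px : p <= delta (s `|` x) x by rewrite leUx kx.
have pz : p <= delta (s `|` z) z by rewrite leUx kz.
suff <- : p = delta s m by exact: leUr.
have Hx := delta_join_le ks kqk px; rewrite (delta_join_inv ms mx) in Hx.
have Hz := delta_join_le ks kqk pz; rewrite (delta_join_inv ms mz) in Hz.
have mp : delta (s `|` p) p = m.
  apply/le_anti; rewrite (mmax _ Hx Hz) /=.
  by have := delta_le_join ks kqk; rewrite deltaK.
have := delta_join_inv ks kqk; rewrite mp => <-.
by rewrite (join_idPl ms).
Qed.

(** * Closure properties of I_g *)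

Lemma translate_upwards_closed I g :
  upwards_closed I -> upwards_closed (translate I g).
Proof.
move=> Iup _ h [f If <-]; set y := g `|` f; set u := delta y f => uh.
have fy : f <= y by exact: leUr.
have uy : u <= y by exact: delta_ge.
set k := delta (y `|` h) h.
have fk : f <= k by rewrite -(deltaK fy); exact: delta_le_join.
have gk : g `|` k = y `|` h.
  by rewrite -(join_delta_join uy uh) /y -joinA (join_idPr fk).
exists k; first exact: Iup fk.
by rewrite gk deltaK ?leUr.
Qed.

Lemma upwards_closed_implication I :
  upwards_closed I -> implication_subalgebra I.
Proof. by move=> Iup x y _ Iy; apply: Iup Iy _; exact: le_imp. Qed.

Lemma translate_meet I g x y m : upwards_closed I ->
  (forall p q r, I p -> I q -> is_meet p q r -> I r) ->
  translate I g x -> translate I g y -> is_meet x y m -> translate I g m.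
Proof.
move=> Iup Imeet [f1 If1 <-] [f2 If2 <-].
set a := g `|` f1; set b := g `|` f2; set x1 := delta a f1.
set y1 := delta b f2 => -[mx my mmax].
have f1a : f1 <= a by exact: leUr.
have f2b : f2 <= b by exact: leUr.
have xa : x1 <= a by exact: delta_ge.
have yb : y1 <= b by exact: delta_ge.
(* Passing from [y1] to [z] keeps the meet with [x1] and makes the join 1, so that [s] joins [x1] to
   [a] and [z] to [t]. *)
set z := cimp x1 y1; have yz : y1 <= z by exact: le_imp.
have mz : m <= z by exact: le_trans yz.
have xzP : is_meet x1 z m.
  by split=> // p px pz; apply: mmax => //; exact: modus_ponens pz.
have xz1 : x1 `|` z = \top by exact: join_imp.
set t := b `|` z; have zt : z <= t by exact: leUr.
have [s sP] := meet_exists (le_trans mx xa) (le_trans mz zt).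
have ms : m <= s.
  by case: sP => _ _; apply; [exact: le_trans xa|exact: le_trans zt].
have sx : s `|` x1 = a.
  apply: join_meet_cover sP xa _; apply/le_anti; rewrite lex1 /= -xz1.
  by rewrite joinC leU2.
have sz : s `|` z = t.
  apply: join_meet_cover (is_meetC sP) zt _; apply/le_anti.
  by rewrite lex1 /= -xz1 leU2.
set k := delta s m.
have kP := delta_meet ms xzP; rewrite sx sz -/k (deltaK f1a) in kP.
set f2' := delta t z in kP.
have f2f : f2 <= f2' by rewrite -(deltaK f2b); exact: delta_le_join.
have Ik : I k by apply: Imeet kP => //; exact: Iup f2f.
have [kf1 kf2 _] := kP; have ks : k <= s by exact: delta_ge.
have f1E : s `|` f1 = a.
  by have := join_delta_join ms mx; rewrite sx (deltaK f1a).
have f2E : s `|` f2' = t by have := join_delta_join ms mz; rewrite sz.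
have gk1 : g `|` k `|` f1 = a by rewrite -joinA (join_idPr kf1).
have gk2 : g `|` k `|` f2' = t.
  rewrite -joinA (join_idPr kf2) -(join_idPr f2f) joinA -/b.
  exact: join_delta_join yb yz.
(* An element above k = f1 /\ f2' is determined by its joins with [f1] and [f2']; here both sides
   give [a] and [t]. *)
have gks : g `|` k = s.
  apply/le_anti/andP; split; apply: (le_joins_meet kP).
  - exact: ks.
  - by rewrite f1E -gk1 leUl.
  - by rewrite f2E -gk2 leUl.
  - exact: leUr.
  - by rewrite gk1 -f1E leUl.
  - by rewrite gk2 -f2E leUl.
by exists k; rewrite ?gks ?deltaK.
Qed.

(** A single map of points, depending only on [e g], carries each [e f] into the interval of its
    translate, so common points go to common points. *)
Lemma translate_compatible I g : compatible I -> compatible (translate I g).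
Proof.
move=> Icomp dB B e eP D DI; have [_ _ eU eD] := eP.
have /choice[c cP] : forall h, exists f,
    translate I g h -> I f /\ delta (g `|` f) f = h.
  move=> h; have [[f If fh]|nh] := pselect (translate I g h).
    by exists f.
  by exists h => /nh.
have [|p pP] := Icomp dB B e eP [fset c h | h in D]%fset.
  move=> f /imfsetP[h /= /DI]; rewrite in_setE => /cP[If _] ->.
  by rewrite in_setE.
(* p' keeps the coordinates of p that agree with g and flips the others. *)
exists ((val (e g)).2 `&` ~` p `|` (val (e g)).1) => h hD.
have := DI _ hD; rewrite in_setE => /cP[_].
have := pP (c h) (in_imfset imfset_key c hD).
rewrite /ipoints /=; move: (c h) => f /andP[fp pf] <-.
rewrite eD ?leUr // eU /ivl_delta /ivl_join /ivl_delta_pair /ivl_join_pair.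
rewrite /ipoints /=; move: (e g) (e f) fp pf.
move=> [[g0 g1] /= g01] [[f0 f1] /= f01] fp pf.
rewrite meetUl meetxC joinx0; apply/andP; split.
  rewrite leUx (le_trans (leIl _ _) (leUr _ _)) /=.
  by apply: lexUl; rewrite leI2 // leC.
rewrite leUx !lexI; apply/andP; split; apply/andP; split.
- by apply: (le_trans (leIl _ _)); exact: leUl.
- by apply: (le_trans (leIr _ _)); apply: lexUr; rewrite leC.
- by apply: (le_trans g01); exact: leUl.
- by rewrite joinIl joinxC meetx1 leUl.
Qed.

Lemma special_translate I g : special I -> special (translate I g).
Proof.
move=> [Iup _ Icomp Imeet]; have Tup := @translate_upwards_closed I g Iup.
split=> //; first exact: upwards_closed_implication.
  exact: translate_compatible.
by move=> x y m; exact: translate_meet.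
Qed.

(** A subalgebra contains I iff it contains I_g: g \/ f lies in I and is its own translate, so it
    lies in both sets, and reflecting in it exchanges [f] with its translate. *)
Lemma cubic_gen_translate I g :
  upwards_closed I -> cubic_gen (translate I g) = cubic_gen I.
Proof.
move=> Iup; rewrite /cubic_gen /smallest; congr (\bigcap_(A in _) A)%classic.
apply/seteqP; split=> A [Asub IA]; split=> //; have [_ _ AD] := Asub.
- move=> f If; have ffg : f <= g `|` f by exact: leUr.
  rewrite -(deltaK ffg); apply: AD; last exact: delta_ge.
    by apply: IA; exists f.
  apply: IA; exists (g `|` f); first exact: Iup If _.
  by rewrite joinA joinxx delta_id.
- move=> _ [f If <-]; have ffg : f <= g `|` f by exact: leUr.
  by apply: AD => //; apply: IA => //; exact: Iup If _.
Qed.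

End CubicTheory.

Theorem theorem7p14 (d : Order.disp_t) (L : cubicType d) (I : set L) (g : L)
  (hI : special I) :
  special (translate I g) /\ cubic_gen (translate I g) = cubic_gen I.
Proof.
split; first exact: special_translate.
by case: hI => Iup _ _ _; exact: cubic_gen_translate.
Qed.
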